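(* Let $(\mathfrak g,[\cdot,\cdot])$ be an action-synchronized $\lim_{n\to\infty}(\phi_{1/n},\psi_{1/n})$-abelian Lie algebra for an action $\gamma:\mathfrak g\to\mathrm{Der}(\mathfrak g)$ and let $D:\mathfrak g\to\mathfrak g$ be a relative differential operator with limit-weight $\lim_{n\to\infty}(\phi_{1/n},\psi_{1/n})$ on $\mathfrak g$ for the action $\gamma$. Define $$\precsim:\mathfrak g\times\mathfrak g\to\mathfrak g,\qquad u\precsim v:=\lim_{n\to\infty}\psi_{1/n}\big(\gamma_u(\phi_{1/n}D(v))\big).$$ Then $(\mathfrak g,\precsim)$ is a Novikov Lie algebra with limit-weight $\lim_{n\to\infty}(\phi_{1/n},\psi_{1/n})$ for the action $\gamma$. In particular, if $\gamma$ is the adjoint action and $\phi_{1/n}=\frac1n\mathrm{id}_{\mathfrak g}$, $\psi_{1/n}=n\,\mathrm{id}_{\mathfrak g}$, then $(\mathfrak g,\precsim)$ is a Novikov Lie algebra.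
   Context: The base field has characteristic zero. Synchronized limits: let $T$ be a topological space and $f_n:T\times T\to T$ ($n\ge1$) maps such that $\lim_{n\to\infty}f_n(a,b)$ uniquely exists for each $(a,b)$. The limit function is synchronized if $\lim_n f_n(a,b)=\lim_n f_n(a_n,b_n)$ for all sequences $a_n\to a$, $b_n\to b$ in $T$. A $\lim_n(\phi_{1/n},\psi_{1/n})$-Lie algebra is a topological Lie algebra $\mathfrak g$ with linear maps $\phi_{1/n},\psi_{1/n}:\mathfrak g\to\mathfrak g$ ($n\ge1$) such that $\phi_{1/n}\psi_{1/n}=\mathrm{id}$ for each $n$, the limit $\lim_n\psi_{1/n}([\phi_{1/n}(u),\phi_{1/n}(v)])$ uniquely exists for all $u,v$, and the resulting map is synchronized. It is $\lim_n(\phi_{1/n},\psi_{1/n})$-abelian if this limit is $0$ for all $u,v$. It is action-synchronized for a Lie algebra action $\gamma:\mathfrak g\to\mathrm{Der}(\mathfrak g)$, $u\mapsto\gamma_u$, if for all $u,v$ the limit $\lim_n\psi_{1/n}(\gamma_u(\phi_{1/n}(v)))$ uniquely exists and equals $\lim_n\psi_{1/n}(\gamma_u(\phi_{1/n}(v_n)))$ for every sequence $v_n\to v$. A relative differential operator with limit-weight $\lim_n(\phi_{1/n},\psi_{1/n})$ on $\mathfrak g$ for $\gamma$ is a linear map $D:\mathfrak g\to\mathfrak g$ with $$D([u,v])=\lim_{n\to\infty}\psi_{1/n}\Big(\gamma_u(\phi_{1/n}D(v))-\gamma_v(\phi_{1/n}D(u))+[\phi_{1/n}D(u),\phi_{1/n}D(v)]\Big),\quad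 u,v\in\mathfrak g.$$ A Novikov Lie algebra with limit-weight $\lim_n(\phi_{1/n},\psi_{1/n})$ for the action $\gamma$ is a pair $(\mathfrak g,\precsim)$ where $\mathfrak g$ is an action-synchronized $\lim_n(\phi_{1/n},\psi_{1/n})$-Lie algebra for $\gamma$ which is also $\lim_n(\phi_{1/n},\psi_{1/n})$-abelian, and $\precsim$ is a bilinear operation with, for all $u,v,w$, $$u\precsim[v,w]=\lim_n\psi_{1/n}\big(\gamma_u(\phi_{1/n}(v\precsim w))\big)-\lim_n\psi_{1/n}\big(\gamma_u(\phi_{1/n}(w\precsim v))\big),$$ $$[u,v]\precsim w=\lim_n\psi_{1/n}\big(\gamma_u(\phi_{1/n}(v\precsim w))\big)-\lim_n\psi_{1/n}\big(\gamma_v(\phi_{1/n}(u\precsim w))\big).$$ A Novikov Lie algebra is a Lie algebra $\mathfrak g$ with a binary (bilinear) operation $\precsim$ satisfying $u\precsim[v,w]=[u,v\precsim w]-[u,w\precsim v]$ and $[u,v]\precsim w=[u,v\precsim w]-[v,u\precsim w]$ for all $u,v,w$. *)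

(* Defs.v *)
From HB Require Import structures.
From mathcomp Require Import all_boot all_order all_algebra.
From mathcomp Require Import all_classical topology pseudometric_normed_Zmodule.

Set Implicit Arguments.
Unset Strict Implicit.
Unset Printing Implicit Defensive.

Import GRing.Theory.

Local Open Scope classical_set_scope.
Local Open Scope ring_scope.

(* The topological modules of the library only allow scalars in a numDomainType,
   with the topology of the norm, and their structures cannot be joined with
   modules over another kind of field.  The base field here is an arbitrary
   topological field (a field without topology is covered by the discrete
   one). *)
HB.mixin Record Field_isTopologicalField K & Topological K & GRing.Field K := {
  field_add_continuous : continuous (fun z : K * K => z.1 + z.2) ;
  field_opp_continuous : continuous (-%R : K -> K) ;
  field_mul_continuous : continuous (fun z : K * K => z.1 * z.2) ;
  field_inv_continuous :
    forall x : K, x != 0 -> {for x, continuous (@GRing.inv K)} ;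
}.

#[short(type="topologicalFieldType")]
HB.structure Definition TopologicalField :=
  {K of Topological K & GRing.Field K & Field_isTopologicalField K}.

HB.mixin Record Lmodule_isLieAlgebra (K : fieldType) L & GRing.Lmodule K L := {
  lie : L -> L -> L ;
  lie_linearl : forall v, linear (lie^~ v) ;
  lie_linearr : forall u, linear (lie u) ;
  liexx : forall u, lie u u = 0 ;
  lie_jacobi : forall u v w,
    lie u (lie v w) + lie v (lie w u) + lie w (lie u v) = 0 ;
}.

#[short(type="lieAlgType")]
HB.structure Definition LieAlgebra (K : fieldType) :=
  {L of GRing.Lmodule K L & Lmodule_isLieAlgebra K L}.

HB.mixin Record LieAlgebra_isTopologicalLieAlgebra (K : topologicalFieldType) L
    & Topological L & LieAlgebra K L := {
  lie_add_continuous : continuous (fun z : L * L => z.1 + z.2) ;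
  lie_opp_continuous : continuous (-%R : L -> L) ;
  lie_scale_continuous : continuous (fun z : K * L => z.1 *: z.2) ;
  lie_continuous : continuous (fun z : L * L => lie z.1 z.2) ;
}.

(* No separation axiom is imposed. *)
#[short(type="topologicalLieAlgType")]
HB.structure Definition TopologicalLieAlgebra (K : topologicalFieldType) :=
  {L of Topological L & LieAlgebra K L
        & LieAlgebra_isTopologicalLieAlgebra K L}.

(* The library's total operator [lim] needs a default value for the sequences
   that do not converge. *)
#[non_forgetful_inheritance]
HB.instance Definition _ (K : topologicalFieldType)
    (L : topologicalLieAlgType K) :=
  isPointed.Build (TopologicalLieAlgebra.sort L) 0.

(* The sequence [u] has the limit [l] and no other limit. *)
Definition ucvg (T : topologicalType) (u : nat -> T) (l : T) : Prop :=
  unique (fun x : T => u @ \oo --> x) l.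

Definition synchronized (T : ptopologicalType) (f : nat -> T -> T -> T) : Prop :=
  (forall a b, exists l, ucvg (fun n => f n a b) l) /\
  (forall (a b : T) (a_ b_ : nat -> T),
      a_ @ \oo --> a -> b_ @ \oo --> b ->
      ucvg (fun n => f n (a_ n) (b_ n)) (limn (fun n => f n a b))).

Section LieAlgebraNotions.
Variables (K : fieldType) (L : lieAlgType K).
Implicit Types (d : L -> L) (gamma prec : L -> L -> L).

Definition is_derivation d : Prop :=
  linear d /\ forall u v, d (lie u v) = lie (d u) v + lie u (d v).

(* [gamma u] is the derivation gamma_u; the map u |-> gamma_u is a morphism to
   the Lie algebra of derivations, whose bracket is the commutator. *)
Definition lie_action gamma : Prop :=
  [/\ forall u, is_derivation (gamma u),
      forall w, linear (gamma^~ w) &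
      forall u v w,
        gamma (lie u v) w = gamma u (gamma v w) - gamma v (gamma u w)].

Definition bilinear_op prec : Prop :=
  (forall v, linear (prec^~ v)) /\ (forall u, linear (prec u)).

Definition novikov_lie prec : Prop :=
  [/\ bilinear_op prec,
      forall u v w, prec u (lie v w) = lie u (prec v w) - lie u (prec w v) &
      forall u v w, prec (lie u v) w = lie u (prec v w) - lie v (prec u w)].

End LieAlgebraNotions.

(* [phi n] and [psi n] stand for phi_{1/n} and psi_{1/n}; only the indices
   n >= 1 are constrained, and the value at n = 0 affects no limit. *)
Section LimitWeight.
Variables (K : topologicalFieldType) (L : topologicalLieAlgType K).
Variables (phi psi : nat -> {linear L -> L}).
Implicit Types (gamma prec : L -> L -> L) (D : L -> L).

Definition limit_lie : Prop :=
  (forall n, (0 < n)%N -> forall x, phi n (psi n x) = x) /\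
  synchronized (fun n u v => psi n (lie (phi n u) (phi n v))).

Definition limit_abelian : Prop :=
  forall u v, ucvg (fun n => psi n (lie (phi n u) (phi n v))) 0.

Definition action_synchronized gamma : Prop :=
  forall u v,
    (exists l, ucvg (fun n => psi n (gamma u (phi n v))) l) /\
    (forall v_ : nat -> L, v_ @ \oo --> v ->
       ucvg (fun n => psi n (gamma u (phi n (v_ n))))
            (limn (fun n => psi n (gamma u (phi n v))))).

Definition relative_diff_op gamma D : Prop :=
  linear D /\
  forall u v,
    ucvg (fun n => psi n (gamma u (phi n (D v)) - gamma v (phi n (D u))
                          + lie (phi n (D u)) (phi n (D v))))
         (D (lie u v)).

Definition novikov_lie_limit_weight gamma prec : Prop :=
  [/\ limit_lie /\ limit_abelian,
      lie_action gamma /\ action_synchronized gamma,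
      bilinear_op prec,
      forall u v w,
        prec u (lie v w) = limn (fun n => psi n (gamma u (phi n (prec v w))))
                           - limn (fun n => psi n (gamma u (phi n (prec w v)))) &
      forall u v w,
        prec (lie u v) w = limn (fun n => psi n (gamma u (phi n (prec v w))))
                           - limn (fun n => psi n (gamma v (phi n (prec u w))))].

Definition limit_prec gamma D (u v : L) : L :=
  limn (fun n => psi n (gamma u (phi n (D v)))).

End LimitWeight.

(* Main.v *)
Require Import Defs.
From mathcomp Require Import all_boot all_order all_algebra.
From mathcomp Require Import all_classical topology.

(** Write [A_n(u) x] for psi_{1/n}(gamma_u(phi_{1/n} x)) and [A(u) x] for its
    limit, so that the new product is [u, v |-> A(u)(D v)].  Abelianness kills
    the quadratic term in the equation of [D], which becomes
    [D [u, v] = A(u)(D v) - A(v)(D u)]; applying the linear map [A(u)] gives the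
    first identity.  For the second one, phi_{1/n} psi_{1/n} = id gives
    [A_n([u, v]) = A_n(u) A_n(v) - A_n(v) A_n(u)], and the action being
    synchronized allows passing to the limit in the nested terms.  Separation of
    the topology is never used: each limit is compared with a sequence whose
    limit is unique by hypothesis. *)

Import GRing.Theory.

Local Open Scope classical_set_scope.
Local Open Scope ring_scope.

Lemma ucvg_limn {T : ptopologicalType} {u : nat -> T} {l : T} :
  ucvg u l -> limn u = l.
Proof.
by move=> [ul uniq]; apply/esym/uniq/cvgP; exact: ul.
Qed.

Lemma ucvg_limnP {T : ptopologicalType} {u : nat -> T} :
  (exists l, ucvg u l) -> ucvg u (limn u).
Proof. by move=> [l ul]; rewrite (ucvg_limn ul). Qed.

(** The weights are constrained at positive indices only, so sequences are compared away from
    [n = 0], which no limit sees. *)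
Lemma cvg_eq_pos {T : topologicalType} {u v : nat -> T} {l : T} :
  (forall n, (0 < n)%N -> u n = v n) -> u @ \oo --> l -> v @ \oo --> l.
Proof.
move=> uv; apply: cvg_trans; apply: near_eq_cvg.
by exists 1%N => // n /= n0; rewrite uv.
Qed.

Section TopologicalLieAlgebraLimits.
Context {K : topologicalFieldType} {L : topologicalLieAlgType K}.
Implicit Types (u v : nat -> L) (l m : L).

Lemma lie_cvgD {u v l m} : u @ \oo --> l -> v @ \oo --> m ->
  (fun n => u n + v n) @ \oo --> l + m.
Proof.
move=> ul vm.
exact: (cvg_comp2 (h := fun x y : L => x + y) ul vm
          (lie_add_continuous (l, m))).
Qed.

Lemma lie_cvgN {u l} : u @ \oo --> l -> (fun n => - u n) @ \oo --> - l.
Proof. by move=> ul; apply: continuous_cvg ul; exact: lie_opp_continuous. Qed.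

Lemma lie_cvgB {u v l m} : u @ \oo --> l -> v @ \oo --> m ->
  (fun n => u n - v n) @ \oo --> l - m.
Proof. by move=> ul vm; exact: lie_cvgD ul (lie_cvgN vm). Qed.

Lemma lie_cvgZ a {u l} : u @ \oo --> l -> (fun n => a *: u n) @ \oo --> a *: l.
Proof.
move=> ul.
exact: (cvg_comp2 (h := fun (b : K) (x : L) => b *: x)
          (cvg_cst a) ul (lie_scale_continuous (a, l))).
Qed.

End TopologicalLieAlgebraLimits.

Section LimitAction.
Context {K : topologicalFieldType} {L : topologicalLieAlgType K}.
Context {phi psi : nat -> {linear L -> L}} {gamma : L -> L -> L}.
Hypothesis hgamma : lie_action gamma.
Hypothesis hsync : action_synchronized phi psi gamma.

Let A n u x := psi n (gamma u (phi n x)).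

Definition limit_action (u x : L) : L :=
  limn (fun n => psi n (gamma u (phi n x))).

Lemma limit_action_ucvg u x : ucvg (fun n => A n u x) (limit_action u x).
Proof. by apply: ucvg_limnP; case: (hsync u x). Qed.

(** Reduces each identity for [limit_action] to exhibiting a single convergence. *)
Lemma limit_action_unique {u x l} : (fun n => A n u x) @ \oo --> l ->
  limit_action u x = l.
Proof. by case: (limit_action_ucvg u x) => _; apply. Qed.

Lemma limit_action_linearr u : linear (limit_action u).
Proof.
move=> a x y; apply: limit_action_unique.
have [Ax _] := limit_action_ucvg u x; have [Ay _] := limit_action_ucvg u y.
apply: cvg_eq_pos (lie_cvgD (lie_cvgZ a Ax) Ay) => n _.
have [/(_ u)[gl _] _ _] := hgamma.
by rewrite /A !linearP gl linearP.
Qed.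

Lemma limit_action_linearl x : linear (limit_action^~ x).
Proof.
move=> a u v; apply: limit_action_unique.
have [Au _] := limit_action_ucvg u x; have [Av _] := limit_action_ucvg v x.
apply: cvg_eq_pos (lie_cvgD (lie_cvgZ a Au) Av) => n _.
have [_ gl _] := hgamma.
by rewrite /A gl linearP.
Qed.

Lemma limit_actionB u x y :
  limit_action u (x - y) = limit_action u x - limit_action u y.
Proof.
by rewrite addrC -scaleN1r limit_action_linearr scaleN1r addrC.
Qed.

Lemma limit_action_lie (phiK : forall n, (0 < n)%N -> cancel (psi n) (phi n))
    u v x :
  limit_action (lie u v) x =
  limit_action u (limit_action v x) - limit_action v (limit_action u x).
Proof.
apply: limit_action_unique.
(* Synchronization is applied at the point [limit_action t x], along the sequence [A n t x] that
   converges to it. *)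
have cvg2 s t : (fun n => A n s (A n t x)) @ \oo -->
    limit_action s (limit_action t x).
  have [Atx _] := limit_action_ucvg t x.
  by have [_ /(_ _ Atx)[]] := hsync s (limit_action t x).
apply: cvg_eq_pos (lie_cvgB (cvg2 u v) (cvg2 v u)) => n n0.
have [_ _ gM] := hgamma.
by rewrite /A !phiK // gM linearB.
Qed.

Lemma relative_diff_op_lie (hab : limit_abelian phi psi) {D : L -> L}
    (hD : relative_diff_op phi psi gamma D) u v :
  D (lie u v) = limit_action u (D v) - limit_action v (D u).
Proof.
have [_ /(_ u v)[_ uniq]] := hD; apply: uniq.
have [Au _] := limit_action_ucvg u (D v).
have [Av _] := limit_action_ucvg v (D u).
have [brk _] := hab (D u) (D v).
(* The added [0] is the limit of the bracket term given by [hab]. *)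
rewrite -[X in _ --> X]addr0.
apply: cvg_eq_pos (lie_cvgD (lie_cvgB Au Av) brk) => n _.
by rewrite /A linearD linearB.
Qed.

End LimitAction.
Arguments limit_action {K L} phi psi gamma u x.

(** The factors [n] and [n^-1] cancel through the linearity of the bracket, so the sequence is
    constant from index 1 on. *)
Lemma limit_action_adjoint {K : topologicalFieldType}
    (charK : [pchar K] =i pred0) {L : topologicalLieAlgType K}
    {phi psi : nat -> {linear L -> L}} {gamma : L -> L -> L}
    (hsync : action_synchronized phi psi gamma)
    (gammaE : forall u v, gamma u v = lie u v)
    (phiE : forall n, (0 < n)%N -> forall x, phi n x = n%:R^-1 *: x)
    (psiE : forall n, (0 < n)%N -> forall x, psi n x = n%:R *: x) u x :
  limit_action phi psi gamma u x = lie u x.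
Proof.
apply: (limit_action_unique hsync); apply: cvg_eq_pos (cvg_cst _) => n n0.
(* Characteristic zero makes every positive [n] invertible in [K]. *)
have nK : n%:R != 0 :> K.
  by move/pcharf0P: charK => ->; rewrite -lt0n.
have lieZ a y : lie u (a *: y) = a *: lie u y.
  have lie0 : lie u (0 : L) = 0.
    by have := lie_linearr u (-1) 0 0; rewrite scaler0 addr0 scaleN1r addNr.
  by have := lie_linearr u a y 0; rewrite !addr0 lie0 addr0.
by rewrite gammaE psiE // phiE // lieZ scalerA divff // scale1r.
Qed.

Theorem proposition4p10 (K : topologicalFieldType) (charK : [pchar K] =i pred0)
    (L : topologicalLieAlgType K) (phi psi : nat -> {linear L -> L})
    (gamma : L -> L -> L) (D : L -> L)
    (hL : limit_lie phi psi) (hab : limit_abelian phi psi)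
    (hgamma : lie_action gamma) (hsync : action_synchronized phi psi gamma)
    (hD : relative_diff_op phi psi gamma D) :
  novikov_lie_limit_weight phi psi gamma (limit_prec phi psi gamma D) /\
  ((forall u v, gamma u v = lie u v) ->
   (forall n, (0 < n)%N -> forall x, phi n x = n%:R^-1 *: x) ->
   (forall n, (0 < n)%N -> forall x, psi n x = n%:R *: x) ->
   novikov_lie (limit_prec phi psi gamma D)).
Proof.
pose A := limit_action phi psi gamma; pose prec := limit_prec phi psi gamma D.
have precE u v : prec u v = A u (D v) by [].
have prec_bilinear : bilinear_op prec.
  split=> [v|u]; first exact: limit_action_linearl.
  move=> a v w; rewrite !precE; case: hD => -> _.
  exact: limit_action_linearr.
have prec_lier u v w : prec u (lie v w) = A u (prec v w) - A u (prec w v).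
  by rewrite precE (relative_diff_op_lie hsync hab hD) /A limit_actionB.
have prec_liel u v w : prec (lie u v) w = A u (prec v w) - A v (prec u w).
  (* This is the commutator relation evaluated at [D w], as [A v (D w)] is [prec v w] by
     definition. *)
  by case: hL => phiK _; exact: limit_action_lie.
split=> // gammaE phiE psiE.
have AE := limit_action_adjoint charK hsync gammaE phiE psiE.
(* Only brackets whose second argument is a product are turned back into [A]; the bracket inside
   [prec] must stay. *)
by split=> // u v w; rewrite -/prec -!(AE _ (prec _ _)).
Qed.
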